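(* Let $M\preceq L$ be symmetric matrices in $\mathbb{R}^{d\times d}$, let $n\ge d$, let $\rho\in[0,1)$, and let $A\in\mathbb{R}^{n\times n}$, $B\in\mathbb{R}^{n\times d}$, $C\in\mathbb{R}^{d\times n}$ be given. Set $\widetilde A=A+BMC$, $\widetilde L=L-M$ and $\Pi=\Pi_{\ker(L-M)}$. Suppose that there exist a symmetric positive definite matrix $P=\begin{pmatrix}P_{11}&P_{12}\\P_{21}&P_{22}\end{pmatrix}\in\mathbb{R}^{(n+d)\times(n+d)}$ (with $P_{11}\in\mathbb{R}^{n\times n}$, $P_{22}\in\mathbb{R}^{d\times d}$), $\lambda\in[0,\rho^2]$ and $r\in\mathbb{R}$ such that $$C(\widetilde A-I_n)^{-1}BM=I_d$$ and $$E^T\begin{pmatrix}-\rho^2P_{11}&-\rho^2P_{12}&0&0\\-\rho^2P_{21}&-\rho^2P_{22}&0&0\\0&0&P_{11}&P_{12}\\0&0&P_{21}&P_{22}\end{pmatrix}E+E^T\begin{pmatrix}0&0&0&-\frac{\lambda}{2}C^T\\0&-r\Pi&0&\frac{\lambda}{2}\widetilde L^\dagger\\0&0&0&\frac12C^T\\-\frac{\lambda}{2}C&\frac{\lambda}{2}\widetilde L^\dagger&\frac12C&-\widetilde L^\dagger-r\Pi\end{pmatrix}E\prec0,$$ where $$E=\begin{pmatrix}I_n&0&0\\0&I_d&0\\\widetilde A&B&0\\0&0&I_d\end{pmatrix}\in\mathbb{R}^{(2n+2d)\times(n+2d)}.$$ Then for every $f\in S(M,L)$ there exist $x_f^*\in\mathbb{R}^n$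 and $c_f\in\mathbb{R}_{\ge0}$ such that $\nabla f(Cx_f^* )=0$ and, for every $x_0\in\mathbb{R}^n$, the iterates $x_{k+1}=Ax_k+B\nabla f(Cx_k)$ satisfy $$\|x_f^*-x_k\|\le c_f\,\rho^k\,\|x_f^*-x_0\|\qquad\text{for all }k\in\mathbb{N}_0.$$
   Context: $S(M,L)$ is the set of all $f\in C^1(\mathbb{R}^d)$ (real-valued) such that for all $z_1,z_2\in\mathbb{R}^d$: $\frac12(z_1-z_2)^TM(z_1-z_2)\le f(z_2)-f(z_1)+(\nabla f(z_1))^T(z_1-z_2)\le\frac12(z_1-z_2)^TL(z_1-z_2)$. $\preceq,\prec$ denote the Loewner order on symmetric matrices ($X\prec0$: negative definite). $X^\dagger$ is the Moore–Penrose pseudoinverse; $\Pi_{\ker X}$ is the orthogonal projection matrix onto $\ker X$; $\|\cdot\|$ is the Euclidean norm. A condition containing an inverse includes the requirement that the inverse exists. Convention $0^0=1$. *)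

(* Defs.v *)
From HB Require Import structures.
From mathcomp Require Import all_boot all_order all_algebra.
From mathcomp Require Import all_classical all_reals all_analysis.
Import numFieldNormedType.Exports.
Import Order.TTheory GRing.Theory Num.Theory.
Set Implicit Arguments.
Unset Strict Implicit.
Unset Printing Implicit Defensive.
Local Open Scope classical_set_scope.
Local Open Scope ring_scope.

Section LinearAlgebra.
Variable R : realType.

Definition quad n (X : 'M[R]_n) (z : 'cV[R]_n) : R := (z^T *m X *m z) 0 0.

(* The library norm on matrices is the sup norm, hence this definition. *)
Definition enorm n (z : 'cV[R]_n) : R := Num.sqrt (\sum_i z i 0 ^+ 2).

Definition symmetric_mx n (X : 'M[R]_n) : Prop := X^T = X.

Definition posdef n (X : 'M[R]_n) : Prop :=
  symmetric_mx X /\ forall z, z != 0 -> 0 < quad X z.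

Definition negdef n (X : 'M[R]_n) : Prop :=
  symmetric_mx X /\ forall z, z != 0 -> quad X z < 0.

(* Used for symmetric X and Y only. *)
Definition loewner_le n (X Y : 'M[R]_n) : Prop :=
  forall z, 0 <= quad (Y - X) z.

Definition is_pinv m n (X : 'M[R]_(m, n)) (Y : 'M[R]_(n, m)) : Prop :=
  [/\ X *m Y *m X = X, Y *m X *m Y = Y,
      symmetric_mx (X *m Y) & symmetric_mx (Y *m X)].

(* The default value 0 is never used: see pinvP. *)
Definition pinv m n (X : 'M[R]_(m, n)) : 'M[R]_(n, m) :=
  xget 0 [set Y | is_pinv X Y].

Definition is_orthproj_ker m n (X : 'M[R]_(m, n)) (Q : 'M[R]_n) : Prop :=
  [/\ Q *m Q = Q, symmetric_mx Q &
      forall z : 'cV[R]_n, X *m z = 0 <-> exists y : 'cV[R]_n, z = Q *m y].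

(* The default value 0 is never used: see orthproj_kerP. *)
Definition orthproj_ker m n (X : 'M[R]_(m, n)) : 'M[R]_n :=
  xget 0 [set Q | is_orthproj_ker X Q].

Lemma gram_unit r n (X : 'M[R]_(r, n)) :
  row_free X -> X *m X^T \in unitmx.
Proof.
move=> Xfree; rewrite -row_free_unit -kermx_eq0; apply/eqP/row_matrixP => i.
rewrite row0; set u := row i _.
have u0 : u *m (X *m X^T) = 0.
  by rewrite /u -row_mul mulmx_ker row0.
suff uX0 : u *m X = 0.
  by apply/eqP; rewrite -(mulmx_free_eq0 u Xfree) uX0.
have h : (u *m X) *m (u *m X)^T = 0.
  by rewrite trmx_mul mulmxA -(mulmxA u) u0 mul0mx.
have := congr1 (fun Y : 'M[R]_1 => Y 0 0) h; rewrite !mxE => /eqP.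
rewrite psumr_eq0 => [/allP h0|j _]; last by rewrite [_^T _ _]mxE -expr2 sqr_ge0.
apply/rowP => j; have := h0 j (mem_index_enum j).
by rewrite [_^T _ _]mxE -expr2 expf_eq0 /= [RHS]mxE => /eqP.
Qed.

Lemma pinv_ex m n (X : 'M[R]_(m, n)) : exists Y, is_pinv X Y.
Proof.
have [r [F [G [XE GU FU]]]] : exists r (F : 'M[R]_(m, r)) (G : 'M[R]_(r, n)),
    [/\ F *m G = X, G *m G^T \in unitmx & F^T *m F \in unitmx].
  exists (\rank X), (col_base X), (row_base X); split.
  - exact: mulmx_base.
  - by apply: gram_unit; exact: row_base_free.
  - rewrite -{2}(trmxK (col_base X)); apply: gram_unit.
    by rewrite /row_free mxrank_tr; exact: col_base_full.
have GV := mulmxV GU; have FV := mulVmx FU.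
set GI := G^T *m invmx (G *m G^T); set FI := invmx (F^T *m F) *m F^T.
have GG : G *m GI = 1%:M by rewrite /GI mulmxA.
have FF : FI *m F = 1%:M by rewrite /FI -mulmxA.
have XY : X *m (GI *m FI) = F *m FI.
  by rewrite -XE -mulmxA (mulmxA G) GG mul1mx.
have YX : (GI *m FI) *m X = GI *m G.
  by rewrite -XE -mulmxA (mulmxA FI) FF mul1mx.
exists (GI *m FI); split.
- by rewrite XY -{1}XE -mulmxA (mulmxA FI) FF mul1mx.
- by rewrite YX -mulmxA (mulmxA G) GG mul1mx.
- by rewrite /symmetric_mx XY /FI mulmxA !trmx_mul trmx_inv trmx_mul !trmxK mulmxA.
- by rewrite /symmetric_mx YX /GI !trmx_mul trmx_inv trmx_mul !trmxK mulmxA.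
Qed.

Lemma pinv_unique m n (X : 'M[R]_(m, n)) Y Z :
  is_pinv X Y -> is_pinv X Z -> Y = Z.
Proof.
move=> [XYX YXY sXY sYX] [XZX ZXZ sXZ sZX].
have e1 : X *m Y = X *m Z.
  by rewrite -sXY -{1}XZX -mulmxA trmx_mul sXY sXZ mulmxA XYX.
have e2 : Y *m X = Z *m X.
  rewrite -sYX -{1}XZX !mulmxA -(mulmxA _ Z) trmx_mul sZX sYX.
  by rewrite -mulmxA (mulmxA X) XYX.
by rewrite -YXY e2 -mulmxA e1 mulmxA ZXZ.
Qed.

Lemma pinvP m n (X : 'M[R]_(m, n)) : is_pinv X (pinv X).
Proof. by have [Y XY] := pinv_ex X; exact: xgetI XY. Qed.

Lemma orthproj_ker_ex m n (X : 'M[R]_(m, n)) :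
  is_orthproj_ker X (1%:M - pinv X *m X).
Proof.
have [XYX YXY _ sYX] := pinvP X; split.
- by rewrite mulmxBl mul1mx mulmxBr mulmx1 mulmxA YXY subrr subr0.
- by rewrite /symmetric_mx linearB /= trmx1 sYX.
- move=> z; split=> [Xz|[y ->]].
    by exists z; rewrite mulmxBl mul1mx -mulmxA Xz mulmx0 subr0.
  by rewrite mulmxA mulmxBr mulmx1 mulmxA XYX subrr mul0mx.
Qed.

Lemma orthproj_ker_unique m n (X : 'M[R]_(m, n)) Q S :
  is_orthproj_ker X Q -> is_orthproj_ker X S -> Q = S.
Proof.
have sub Q1 Q2 : is_orthproj_ker X Q1 -> is_orthproj_ker X Q2 ->
    Q1 *m Q2 = Q2.
  move=> [Q11 _ Q1X] [_ _ Q2X]; apply/matrixP => i j.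
  have : X *m (Q2 *m delta_mx j (0 : 'I_1)) = 0.
    by apply/Q2X; exists (delta_mx j 0).
  move/Q1X => [y yE].
  have : Q1 *m (Q2 *m delta_mx j 0) = Q2 *m delta_mx j (0 : 'I_1).
    by rewrite yE mulmxA Q11.
  by rewrite mulmxA -!colE => /colP/(_ i); rewrite !mxE.
move=> hQ hS; have [_ sQ _] := hQ; have [_ sS _] := hS.
by rewrite -(sub _ _ hS hQ) -sQ -sS -trmx_mul (sub _ _ hQ hS) sS.
Qed.

Lemma orthproj_kerP m n (X : 'M[R]_(m, n)) :
  is_orthproj_ker X (orthproj_ker X).
Proof. exact: xgetI (orthproj_ker_ex X). Qed.

End LinearAlgebra.

Section FunctionClass.
Variables (R : realType) (d : nat).

Definition gradient (f : 'cV[R]_d -> R) (z : 'cV[R]_d) : 'cV[R]_d :=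
  \col_i 'D_(delta_mx i 0) f z.

Definition C1 (f : 'cV[R]_d -> R) : Prop :=
  (forall z, differentiable f z) /\ continuous (gradient f).

Definition class_S (M L : 'M[R]_d) (f : 'cV[R]_d -> R) : Prop :=
  C1 f /\
  forall z1 z2 : 'cV[R]_d,
    2^-1 * quad M (z1 - z2)
      <= f z2 - f z1 + ((gradient f z1)^T *m (z1 - z2)) 0 0
      <= 2^-1 * quad L (z1 - z2).

End FunctionClass.

Section LMI.
Variables (R : realType) (n d : nat).

(* The 4 x 4 block matrix with rows (a11 a12 a13 a14), ..., (a41 ... a44). *)
Definition block4_mx
    (a11 : 'M[R]_(n, n)) (a12 : 'M[R]_(n, d)) (a13 : 'M[R]_(n, n)) (a14 : 'M[R]_(n, d))
    (a21 : 'M[R]_(d, n)) (a22 : 'M[R]_(d, d)) (a23 : 'M[R]_(d, n)) (a24 : 'M[R]_(d, d))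
    (a31 : 'M[R]_(n, n)) (a32 : 'M[R]_(n, d)) (a33 : 'M[R]_(n, n)) (a34 : 'M[R]_(n, d))
    (a41 : 'M[R]_(d, n)) (a42 : 'M[R]_(d, d)) (a43 : 'M[R]_(d, n)) (a44 : 'M[R]_(d, d)) :
    'M[R]_((n + d) + (n + d)) :=
  block_mx (block_mx a11 a12 a21 a22) (block_mx a13 a14 a23 a24)
           (block_mx a31 a32 a41 a42) (block_mx a33 a34 a43 a44).

Definition lmi_E (At : 'M[R]_n) (B : 'M[R]_(n, d)) :
    'M[R]_((n + d) + (n + d), (n + d) + d) :=
  col_mx (col_mx (row_mx (row_mx 1%:M 0)    0)
                 (row_mx (row_mx 0    1%:M) 0))
         (col_mx (row_mx (row_mx At   B)    0)
                 (row_mx (row_mx 0    0)    1%:M)).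

Definition lmi_P (rho : R) (P : 'M[R]_(n + d)) : 'M[R]_((n + d) + (n + d)) :=
  let P11 := ulsubmx P in let P12 := ursubmx P in
  let P21 := dlsubmx P in let P22 := drsubmx P in
  block4_mx
    (- (rho ^+ 2) *: P11) (- (rho ^+ 2) *: P12) 0   0
    (- (rho ^+ 2) *: P21) (- (rho ^+ 2) *: P22) 0   0
    0                     0                     P11 P12
    0                     0                     P21 P22.

Definition lmi_multiplier (lam r : R) (C : 'M[R]_(d, n)) (Lt : 'M[R]_d) :
    'M[R]_((n + d) + (n + d)) :=
  let Ld := pinv Lt in let Pi := orthproj_ker Lt in
  block4_mx
    0                  0                 0            (- (lam / 2) *: C^T)
    0                  (- r *: Pi)       0            ((lam / 2) *: Ld)
    0                  0                 0            (2^-1 *: C^T)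
    (- (lam / 2) *: C) ((lam / 2) *: Ld) (2^-1 *: C)  (- Ld - r *: Pi).

End LMI.

(* Main.v *)
From HB Require Import structures.
Require Import Defs.
From mathcomp Require Import all_boot all_order all_algebra.
From mathcomp Require Import ring lra.
From mathcomp Require Import all_classical all_reals all_analysis.
Import numFieldNormedType.Exports.
Import Order.TTheory GRing.Theory Num.Theory.
Set Implicit Arguments.
Unset Strict Implicit.
Unset Printing Implicit Defensive.
Local Open Scope ring_scope.

(* Put g(z) = f(z) - z^T M z / 2 and Lt = L - M. Then g is convex and its
   Bregman divergence D satisfies 0 <= D(z1, z2) <= (z2 - z1)^T Lt (z2 - z1) / 2,
   so D(z1, z2) >= w^T Lt^+ w / 2 and w lies in the range of Lt, for
   w = grad g(z2) - grad g(z1). The iteration reads x' = At x + B grad g(C x).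

   Critical point. At (x, u, u) with x = At x + B u, the LMI says that
   M^-1 + Lt^+ is positive definite on the range of Lt. With the cocoercivity of
   grad g this makes the maps t grad g + M, for t in [0, 1], injective with a
   Lipschitz inverse, uniformly in t. As M is onto, finitely many applications
   of the Banach fixed point theorem show that grad g + M = grad f is onto.

   Convergence. Let xf = (At - I)^-1 B M zf for a critical point zf, so that
   C xf = zf, and w = grad g(C x) - grad g(zf). The LMI at
   (x_k - xf, w_k, w_(k+1)), together with the interpolation inequality at the
   pairs (C x_(k+1), zf) and (C x_(k+1), C x_k) weighted by 1 - lambda and
   lambda, shows that the Lyapunov function
   (x - xf, w)^T P (x - xf, w) + D(zf, C x) - w^T Lt^+ w / 2
   decreases by the factor rho^2 at each step. *)

(* MathComp-Analysis has another [pinv], for functions. *)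
Local Notation pinv := Defs.pinv.

(* Joins the complete and the normed structure of matrices. *)
HB.instance Definition _ (R : realType) (m n : nat) := Complete.on 'M[R]_(m, n).

(** * Inner product, quadratic forms and sup-norm estimates *)

Section Dot.
Context {R : realType}.

Definition dot {n} (a b : 'cV[R]_n) : R := (a^T *m b) 0 0.

Lemma dotE n (a b : 'cV[R]_n) : dot a b = \sum_i a i 0 * b i 0.
Proof. by rewrite /dot mxE; apply: eq_bigr => i _; rewrite mxE. Qed.

Lemma dotC n (a b : 'cV[R]_n) : dot a b = dot b a.
Proof. by rewrite !dotE; apply: eq_bigr => i _; rewrite mulrC. Qed.

Lemma dotDr n (a b c : 'cV[R]_n) : dot a (b + c) = dot a b + dot a c.
Proof. by rewrite /dot mulmxDr mxE. Qed.

Lemma dotDl n (a b c : 'cV[R]_n) : dot (a + b) c = dot a c + dot b c.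
Proof. by rewrite !(dotC _ c) dotDr. Qed.

Lemma dotZr n k (a b : 'cV[R]_n) : dot a (k *: b) = k * dot a b.
Proof. by rewrite /dot -scalemxAr mxE. Qed.

Lemma dotZl n k (a b : 'cV[R]_n) : dot (k *: a) b = k * dot a b.
Proof. by rewrite !(dotC _ b) dotZr. Qed.

Lemma dotNr n (a b : 'cV[R]_n) : dot a (- b) = - dot a b.
Proof. by rewrite -scaleN1r dotZr mulN1r. Qed.

Lemma dotNl n (a b : 'cV[R]_n) : dot (- a) b = - dot a b.
Proof. by rewrite !(dotC _ b) dotNr. Qed.

Lemma dot0r n (a : 'cV[R]_n) : dot a 0 = 0.
Proof. by rewrite /dot mulmx0 mxE. Qed.

Lemma dot0l n (a : 'cV[R]_n) : dot 0 a = 0.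
Proof. by rewrite dotC dot0r. Qed.

Definition dotB := (dotDl, dotDr, dotNl, dotNr, dotZl, dotZr).

Lemma dot_mulmx m n (X : 'M[R]_(m, n)) a b :
  dot a (X *m b) = dot (X^T *m a) b.
Proof. by rewrite /dot trmx_mul trmxK mulmxA. Qed.

Lemma dot_sym n (X : 'M[R]_n) a b :
  symmetric_mx X -> dot a (X *m b) = dot b (X *m a).
Proof. by move=> sX; rewrite dot_mulmx sX dotC. Qed.

Lemma quadE n (X : 'M[R]_n) z : quad X z = dot z (X *m z).
Proof. by rewrite /quad /dot mulmxA. Qed.

Lemma dot_eq0 n (z : 'cV[R]_n) : dot z z = 0 -> z = 0.
Proof.
rewrite dotE => /eqP; rewrite psumr_eq0 => [/allP z0|i _]; last first.
  by rewrite -expr2 sqr_ge0.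
apply/colP => i; have := z0 i (mem_index_enum i).
by rewrite -expr2 sqrf_eq0 mxE => /eqP.
Qed.

Lemma dot_col_mx m n (a c : 'cV[R]_m) (b d : 'cV[R]_n) :
  dot (col_mx a b) (col_mx c d) = dot a c + dot b d.
Proof. by rewrite /dot tr_col_mx mul_row_col mxE. Qed.

Lemma dot_delta n (z : 'cV[R]_n) i : dot (delta_mx i 0) z = z i 0.
Proof. by rewrite /dot trmx_delta -rowE mxE. Qed.

Lemma quad0 n (X : 'M[R]_n) : quad X 0 = 0.
Proof. by rewrite quadE dot0l. Qed.

(** The polynomial [t -> quad X (a + t *: b)] is nonnegative, which bounds its discriminant. *)
Lemma psd_cauchy_schwarz n (X : 'M[R]_n) a b :
  symmetric_mx X -> (forall z, 0 <= quad X z) ->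
  dot a (X *m b) ^+ 2 <= quad X a * quad X b.
Proof.
move=> sX X0; set p := dot a (X *m b).
have H t : 0 <= quad X a + 2 * t * p + t ^+ 2 * quad X b.
  suff <- : quad X (a + t *: b) = quad X a + 2 * t * p + t ^+ 2 * quad X b by [].
  rewrite !quadE mulmxDr -scalemxAr !dotB (dot_sym b a sX) -/p; ring.
have [q0|q0] := eqVneq (quad X b) 0.
  have [p0|p0] := eqVneq p 0; first by rewrite p0 q0 mulr0 expr0n.
  (* The polynomial is affine here, and this [t] would give it the value -1. *)
  have := H (- (quad X a + 1) / (2 * p)); rewrite q0 mulr0 addr0.
  have -> : 2 * (- (quad X a + 1) / (2 * p)) * p = - (quad X a + 1) by field.
  lra.
have qgt0 : 0 < quad X b by rewrite lt_def q0 X0.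
(* This [t] is the minimizer of the polynomial. *)
have := H (- p / quad X b).
have -> : quad X a + 2 * (- p / quad X b) * p + (- p / quad X b) ^+ 2 * quad X b
  = quad X a - p ^+ 2 / quad X b by field.
by rewrite subr_ge0 ler_pdivrMr.
Qed.

Lemma coord_le_norm n (z : 'cV[R]_n) i : `|z i 0| <= `|z|.
Proof.
by rewrite [leRHS]/Num.Def.normr /= mx_normrE; exact: (le_bigmax _ _ (i, 0)).
Qed.

Lemma norm_le_coord n (z : 'cV[R]_n) b :
  0 <= b -> (forall i, `|z i 0| <= b) -> `|z| <= b.
Proof.
move=> b0 zb; rewrite [leLHS]/Num.Def.normr /= mx_normrE.
apply: bigmax_le => // -[i j] _.
by rewrite ord1.
Qed.

Lemma sqr_norm_le_coord n (z : 'cV[R]_n) b :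
  0 <= b -> (forall i, z i 0 ^+ 2 <= b) -> `|z| ^+ 2 <= b.
Proof.
move=> b0 zb; rewrite -(sqr_sqrtr b0) lerXn2r ?nnegrE ?sqrtr_ge0 //.
apply: norm_le_coord => [|i]; first exact: sqrtr_ge0.
by rewrite -sqrtr_sqr ler_sqrt.
Qed.

Lemma norm_dot_le n (a b : 'cV[R]_n) : `|dot a b| <= n%:R * (`|a| * `|b|).
Proof.
rewrite dotE (le_trans (ler_norm_sum _ _ _)) // mulr_natl.
rewrite -[X in _ *+ X]card_ord -sumr_const; apply: ler_sum => i _.
by rewrite normrM ler_pM // coord_le_norm.
Qed.

Lemma norm_mulmx_le m n (X : 'M[R]_(m, n)) :
  exists2 c, 0 <= c & forall z : 'cV[R]_n, `|X *m z| <= c * `|z|.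
Proof.
exists (\sum_i n%:R * `|(row i X)^T|) => [|z].
  by apply: sumr_ge0 => i _; rewrite mulr_ge0.
apply: norm_le_coord => [|i].
  by rewrite mulr_ge0 //; apply: sumr_ge0 => i _; rewrite mulr_ge0.
have -> : (X *m z) i 0 = dot (row i X)^T z by rewrite /dot trmxK -row_mul [RHS]mxE.
rewrite (le_trans (norm_dot_le _ _)) // mulrA ler_wpM2r //.
rewrite (bigD1 i) //= lerDl.
by apply: sumr_ge0 => j _; rewrite mulr_ge0.
Qed.

Lemma quad_le n (X : 'M[R]_n) :
  exists2 c, 0 <= c & forall z, quad X z <= c * `|z| ^+ 2.
Proof.
have [c c0 cX] := norm_mulmx_le X.
exists (n%:R * c) => [|z]; first by rewrite mulr_ge0.
rewrite quadE (le_trans (ler_norm _)) // (le_trans (norm_dot_le _ _)) //.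
rewrite -mulrA ler_wpM2l // expr2 mulrCA ler_wpM2l //.
Qed.

(** Coordinate i of [X *m z] is [e_i^T X z], to which Cauchy-Schwarz applies; the constant is the
    trace of [X]. *)
Lemma psd_sqr_norm_mulmx_le n (X : 'M[R]_n) :
  symmetric_mx X -> (forall z, 0 <= quad X z) ->
  exists2 c, 0 <= c & forall z, `|X *m z| ^+ 2 <= c * quad X z.
Proof.
move=> sX X0; exists (\sum_i quad X (delta_mx i 0)) => [|z].
  by apply: sumr_ge0.
apply: sqr_norm_le_coord => [|i].
  by rewrite mulr_ge0 // sumr_ge0.
rewrite -dot_delta (le_trans (psd_cauchy_schwarz _ _ sX X0)) //.
by rewrite ler_wpM2r // (bigD1 i) //= lerDl sumr_ge0.
Qed.

(** As [X] is invertible, [z = X^-1 (X z)] is controlled by [X z], hence by [quad X z]; no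
    compactness of the sphere is involved. *)
Lemma posdef_coercive n (X : 'M[R]_n) :
  posdef X -> exists2 c, 0 <= c & forall z, `|z| ^+ 2 <= c * quad X z.
Proof.
move=> [sX X0].
have X0' z : 0 <= quad X z.
  by have [->|/X0/ltW//] := eqVneq z 0; rewrite quad0.
have uX : X \in unitmx.
  rewrite -row_free_unit -kermx_eq0; apply/eqP/row_matrixP => i; rewrite row0.
  apply/eqP; rewrite -trmx_eq0; apply: contraT => /X0.
  by rewrite /quad trmxK -row_mul mulmx_ker row0 mul0mx mxE ltxx.
have [c c0 cX] := psd_sqr_norm_mulmx_le sX X0'.
have [b b0 bX] := norm_mulmx_le (invmx X).
exists (b ^+ 2 * c) => [|z]; first by rewrite mulr_ge0 ?sqr_ge0.
rewrite -{1}(mulKmx uX z) -mulrA.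
apply: le_trans (ler_wpM2l (sqr_ge0 b) (cX z)).
by rewrite -exprMn lerXn2r ?nnegrE ?mulr_ge0.
Qed.

Lemma enormE n (z : 'cV[R]_n) : enorm z = Num.sqrt (dot z z).
Proof. by rewrite /enorm dotE; under eq_bigr do rewrite expr2. Qed.

Lemma norm_le_enorm n (z : 'cV[R]_n) : `|z| <= enorm z.
Proof.
apply: norm_le_coord => [|i]; first exact: sqrtr_ge0.
rewrite -sqrtr_sqr ler_sqrt; last by apply: sumr_ge0 => j _; rewrite sqr_ge0.
by rewrite (bigD1 i) //= lerDl; apply: sumr_ge0 => j _; rewrite sqr_ge0.
Qed.

Lemma enorm_le_norm n (z : 'cV[R]_n) : enorm z <= Num.sqrt n%:R * `|z|.
Proof.
rewrite enormE -[`|z|]normr_id -sqrtr_sqr -sqrtrM // ler_sqrt ?mulr_ge0 ?sqr_ge0 //.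
by rewrite (le_trans (ler_norm _)) // expr2 norm_dot_le.
Qed.

Lemma quad_congr m k (X : 'M[R]_m) (Y : 'M[R]_(m, k)) z :
  quad (Y^T *m X *m Y) z = quad X (Y *m z).
Proof. by rewrite !quadE -!mulmxA dot_mulmx trmxK. Qed.

Lemma quadD m (X Y : 'M[R]_m) z : quad (X + Y) z = quad X z + quad Y z.
Proof. by rewrite !quadE mulmxDl dotDr. Qed.

Lemma norm_usub_le m k (a : 'cV[R]_m) (b : 'cV[R]_k) : `|a| <= `|col_mx a b|.
Proof.
apply: norm_le_coord => // i.
by rewrite -(col_mxEu a b i 0) coord_le_norm.
Qed.

Lemma norm_dsub_le m k (a : 'cV[R]_m) (b : 'cV[R]_k) : `|b| <= `|col_mx a b|.
Proof.
apply: norm_le_coord => // i.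
by rewrite -(col_mxEd a b i 0) coord_le_norm.
Qed.

Lemma norm_col_mx_le m k (a : 'cV[R]_m) (b : 'cV[R]_k) :
  `|col_mx a b| <= `|a| + `|b|.
Proof.
apply: norm_le_coord => [|i]; first by rewrite addr_ge0.
rewrite mxE; case: (fintype.split i) => j /=.
  by rewrite (le_trans (coord_le_norm _ _)) // lerDl.
by rewrite (le_trans (coord_le_norm _ _)) // lerDr.
Qed.

Lemma negdef_coercive m (X : 'M[R]_m) :
  negdef X -> exists2 c, 0 <= c & forall z, `|z| ^+ 2 <= c * - quad X z.
Proof.
move=> [sX X0].
have quadN z : quad (- X) z = - quad X z by rewrite !quadE mulNmx dotNr.
have [|c c0 cX] := @posdef_coercive m (- X).
  split=> [|z /X0]; last by rewrite quadN oppr_gt0.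
  by rewrite /symmetric_mx linearN /= sX.
by exists c => // z; rewrite -quadN.
Qed.

Lemma negdef_quad_le0 m (X : 'M[R]_m) z : negdef X -> quad X z <= 0.
Proof.
by move=> [_ X0]; have [->|/X0/ltW//] := eqVneq z 0; rewrite quad0.
Qed.

End Dot.

(** The transpose of [pinv X] also solves the Penrose equations of [X], whose solution is unique. *)
Lemma pinv_sym (R : realType) n (X : 'M[R]_n) :
  symmetric_mx X -> symmetric_mx (pinv X).
Proof.
move=> sX; have [XYX YXY sXY sYX] := pinvP X.
apply: (@pinv_unique _ _ _ X); last exact: pinvP.
have XYt : X *m (pinv X)^T = pinv X *m X.
  by rewrite -[LHS]trmxK trmx_mul trmxK sX sYX.
have YtX : (pinv X)^T *m X = X *m pinv X.
  by rewrite -[LHS]trmxK trmx_mul trmxK sX sXY.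
split; rewrite /symmetric_mx ?XYt ?YtX //; apply: trmx_inj.
- by rewrite trmx_mul sYX sX mulmxA.
- by rewrite trmx_mul sXY trmxK mulmxA.
Qed.

(** * Interpolation inequalities for convex functions with a quadratic upper bound *)

Section SmoothConvex.
Context {R : realType} {d : nat}.
Variables (g : 'cV[R]_d -> R) (G : 'cV[R]_d -> 'cV[R]_d) (X : 'M[R]_d).

Definition bregman z1 z2 := g z2 - g z1 - dot (G z1) (z2 - z1).

Hypotheses (sX : symmetric_mx X).
Hypothesis bregman_bounds :
  forall z1 z2, 0 <= bregman z1 z2 <= 2^-1 * quad X (z2 - z1).

Lemma smooth_psd z : 0 <= quad X z.
Proof. by have := bregman_bounds 0 z; rewrite subr0; lra. Qed.

(* Convexity makes the left-hand side nonnegative at every point, in particular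
   at [z2 - v]; the upper bound at [z2] then controls it from above. *)
Lemma bregman_step z1 z2 v :
  dot (G z2 - G z1) v <= bregman z1 z2 + 2^-1 * quad X v.
Proof.
have /andP[+ _] := bregman_bounds z1 (z2 - v).
have /andP[_ +] := bregman_bounds z2 (z2 - v).
have -> : z2 - v - z2 = - v by rewrite addrAC subrr sub0r.
rewrite (_ : quad X (- v) = quad X v); last first.
  by rewrite !quadE mulmxN !dotB opprK.
rewrite /bregman !dotB; lra.
Qed.

(** Along the kernel the quadratic term of [bregman_step] vanishes, so a linear function of [t] is
    bounded above and must be zero. *)
Lemma gradient_diff_ker z1 z2 v : X *m v = 0 -> dot (G z2 - G z1) v = 0.
Proof.
move=> Xv; set w := dot _ _.
have H t : t * w <= bregman z1 z2.
  have := bregman_step z1 z2 (t *: v).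
  by rewrite quadE -scalemxAr Xv scaler0 dot0r mulr0 addr0 dotZr.
have [//|w0] := eqVneq w 0.
have := H ((bregman z1 z2 + 1) / w); rewrite divfK //; lra.
Qed.

Lemma orthproj_gradient_diff z1 z2 : orthproj_ker X *m (G z2 - G z1) = 0.
Proof.
have [QQ sQ QX] := orthproj_kerP X; set w := G z2 - G z1.
apply: dot_eq0; rewrite dot_mulmx sQ mulmxA QQ dotC.
by apply: gradient_diff_ker; apply/QX; exists w.
Qed.

(** Gradient differences are orthogonal to the kernel of the symmetric [X], hence lie in its range,
    where [X X^+] is the identity. *)
Lemma pinv_gradient_diff z1 z2 :
  X *m (pinv X *m (G z2 - G z1)) = G z2 - G z1.
Proof.
have [XYX YXY sXY sYX] := pinvP X; set w := G z2 - G z1.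
have := orthproj_gradient_diff z1 z2.
rewrite (orthproj_ker_unique (orthproj_kerP X) (orthproj_ker_ex X)) -/w.
rewrite mulmxBl mul1mx => /eqP; rewrite subr_eq0 => /eqP {2}->.
by rewrite mulmxA -sXY trmx_mul (pinv_sym sX) sX.
Qed.

(** With [w] the gradient difference, [v = X^+ w] maximizes [w^T v - v^T X v / 2] in
    [bregman_step]. *)
Lemma bregman_ge_pinv z1 z2 :
  2^-1 * quad (pinv X) (G z2 - G z1) <= bregman z1 z2.
Proof.
have := bregman_step z1 z2 (pinv X *m (G z2 - G z1)).
rewrite quadE pinv_gradient_diff !quadE.
rewrite (dotC (pinv X *m _)); lra.
Qed.

Lemma pinv_quad_ge0 z1 z2 : 0 <= quad (pinv X) (G z2 - G z1).
Proof.
have := smooth_psd (pinv X *m (G z2 - G z1)).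
by rewrite !quadE pinv_gradient_diff dotC.
Qed.

(** The function values cancel when [bregman_ge_pinv] is added to itself with the points
    exchanged. *)
Lemma cocoercive z1 z2 :
  quad (pinv X) (G z2 - G z1) <= dot (G z2 - G z1) (z2 - z1).
Proof.
have := bregman_ge_pinv z1 z2; have := bregman_ge_pinv z2 z1.
rewrite !quadE /bregman -(opprB (G z2)) -(opprB z2) mulmxN !dotB; lra.
Qed.

(** Write [w = X (X^+ w)]. Then [|w|^2] is at most a multiple of [w^T X^+ w], which lies below twice
    the Bregman divergence and so below [quad X (z2 - z1)]. *)
Lemma gradient_lipschitz :
  exists2 k, 0 <= k & forall z1 z2, `|G z2 - G z1| <= k * `|z2 - z1|.
Proof.
have [c c0 cX] := psd_sqr_norm_mulmx_le sX smooth_psd.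
have [b b0 bX] := quad_le X.
exists (Num.sqrt (c * b)) => [|z1 z2]; first exact: sqrtr_ge0.
rewrite -[leLHS]normr_id -[`|z2 - z1|]normr_id -!sqrtr_sqr -sqrtrM ?mulr_ge0 //.
rewrite ler_sqrt ?mulr_ge0 // ?sqr_ge0 //.
rewrite -{1}pinv_gradient_diff (le_trans (cX _)) // -mulrA ler_wpM2l //.
apply: le_trans (bX _).
have := bregman_ge_pinv z1 z2; have /andP[_] := bregman_bounds z1 z2.
rewrite !quadE pinv_gradient_diff (dotC (pinv X *m _)); lra.
Qed.

End SmoothConvex.

(** * Surjectivity by continuation in a parameter *)

Section Continuation.
Context {R : realType} {E : completeNormedModType R}.

Lemma lipschitz_fixed_point (T : E -> E) q :
  0 <= q < 1 -> (forall x y, `|T x - T y| <= q * `|x - y|) -> exists p, p = T p.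
Proof.
move=> /andP[q0 q1] qT.
have ctr : is_contraction [fun of totalfun T].
  exists (NngNum q0); split=> //= -[x y] _ /=; exact: qT.
have [|p _ pT] := banach_fixed_point ctr closedT; first by exists point.
by exists p.
Qed.

(** The parameter [t] goes from 0 to 1 in [N] equal steps. The expansion bound does not depend on
    [t], so one step length serves throughout. *)
Lemma continuation_surjective (H M : E -> E) (k c : R) :
  0 <= k -> 0 <= c ->
  (forall x y, `|H x - H y| <= k * `|x - y|) ->
  (forall y, exists x, M x = y) ->
  (forall t, 0 <= t <= 1 -> forall x y,
     `|x - y| <= c * `|t *: (H x - H y) + (M x - M y)|) ->
  forall y, exists x, H x + M x = y.
Proof.
move=> k0 c0 kH surjM expand.
(* A step of length [1 / N] makes the contraction factor [c * k / N] less than 1. *)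
set N := (Num.bound (c * k)).+1.
have N0 : 0 < N%:R :> R by rewrite ltr0n.
have ckN : c * k < N%:R.
  have /archi_boundP/lt_le_trans : 0 <= c * k by rewrite mulr_ge0.
  by apply; rewrite ler_nat.
suff surj j : (j <= N)%N -> forall y, exists x, (j%:R / N%:R) *: H x + M x = y.
  move=> y; have [x] := surj N (leqnn _) y.
  by rewrite divff ?gt_eqF // scale1r; exists x.
elim: j => [_ y|j IH jN y].
  by have [x Mx] := surjM y; exists x; rewrite mul0r scale0r add0r.
have /choice[T TP] := IH (ltnW jN).
(* [T] inverts the map at parameter [j / N]; moving the extra term [H / N] to the right-hand side
   turns the equation at [(j + 1) / N] into this fixed point problem. *)
have [||p pT] := @lipschitz_fixed_point (fun z => T (y - N%:R^-1 *: H z)) (c * k / N%:R).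
- by rewrite divr_ge0 ?mulr_ge0 //= ltr_pdivrMr // mul1r.
- move=> z1 z2; set x1 := T _; set x2 := T _.
  have t01 : 0 <= (j%:R / N%:R : R) <= 1.
    by rewrite divr_ge0 //= ler_pdivrMr // mul1r ler_nat ltnW.
  rewrite (le_trans (expand _ t01 x1 x2)) // -!mulrA ler_wpM2l //.
  have -> : (j%:R / N%:R) *: (H x1 - H x2) + (M x1 - M x2)
      = N%:R^-1 *: (H z2 - H z1).
    rewrite scalerBr addrACA -opprD !TP scalerBr opprB addrC.
    by rewrite addrA subrK.
  rewrite normrZ ger0_norm ?invr_ge0 // mulrCA ler_wpM2l ?invr_ge0 //.
  by rewrite distrC.
- exists p; have := TP (y - N%:R^-1 *: H p); rewrite -pT => e.
  by rewrite -natr1 mulrDl mul1r scalerDl addrAC e subrK.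
Qed.

End Continuation.

(** * The matrix inequality as a quadratic form *)

Section LMI.
Context {R : realType} {n d : nat}.

Lemma lmi_PE (rho : R) (P : 'M[R]_(n + d)) :
  lmi_P rho P = block_mx (- (rho ^+ 2) *: P) 0 0 P.
Proof.
rewrite /lmi_P /block4_mx submxK -scale_block_mx submxK.
by rewrite !block_mx0.
Qed.

Lemma lmi_E_col (At : 'M[R]_n) (B : 'M[R]_(n, d)) x u w :
  lmi_E At B *m col_mx (col_mx x u) w
  = col_mx (col_mx x u) (col_mx (At *m x + B *m u) w) :> 'cV[R]_((n + d) + (n + d)).
Proof.
by rewrite /lmi_E !mul_col_mx !mul_row_col
  !mul1mx !mul0mx !addr0 !add0r.
Qed.

(** The kernel conditions, met by gradient differences, cancel the terms in [r]. What remains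
    compares [P] before and after one step, plus supply terms. *)
Lemma quad_lmi (At : 'M[R]_n) (B : 'M[R]_(n, d)) (C : 'M[R]_(d, n))
    (Lt : 'M[R]_d) (rho lam r : R) (P : 'M[R]_(n + d)) x u w :
  symmetric_mx Lt -> orthproj_ker Lt *m u = 0 -> orthproj_ker Lt *m w = 0 ->
  let E := lmi_E At B in
  quad (E^T *m lmi_P rho P *m E + E^T *m lmi_multiplier lam r C Lt *m E)
    (col_mx (col_mx x u) w)
  = quad P (col_mx (At *m x + B *m u) w) - rho ^+ 2 * quad P (col_mx x u)
    + dot w (C *m (At *m x + B *m u) - pinv Lt *m w)
    - lam * dot w (C *m x - pinv Lt *m u).
Proof.
move=> sL Qu Qw E.
rewrite quadD !quad_congr lmi_E_col lmi_PE /lmi_multiplier /block4_mx.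
move: (At *m x + B *m u) => x'.
rewrite !quadE !mul_block_col.
rewrite !(mul0mx, add0r, addr0, mulmxDl, mulmxBl, mulNmx) -!scalemxAl.
rewrite Qu Qw !(scaler0, oppr0, subr0, add0r, addr0) !dot_col_mx.
rewrite !dotDr !dot_col_mx !dotB !dot0r !(dot_mulmx C^T) !trmxK.
rewrite (dotC (C *m x)) (dotC (C *m x')).
rewrite (dot_sym u w (pinv_sym sL)).
by field.
Qed.

End LMI.

(** * Existence of a critical point *)

Section CriticalPoint.
Context {R : realType} {d : nat}.

(** Continuation applied to [G] and [M]. For the expansion bound, [W = t *: w] is first bounded by
    the residual [phi]; then [D = M^-1 (phi - W)] bounds [D]. *)
Lemma critical_point_exists (M Lt : 'M[R]_d) g G kappa :
  symmetric_mx Lt ->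
  (forall z1 z2, 0 <= bregman g G z1 z2 <= 2^-1 * quad Lt (z2 - z1)) ->
  M \in unitmx -> 0 <= kappa ->
  (forall u : 'cV[R]_d, orthproj_ker Lt *m u = 0 ->
     `|u| ^+ 2 <= kappa * (dot u (invmx M *m u) + quad (pinv Lt) u)) ->
  exists z, G z + M *m z = 0.
Proof.
move=> sL gL uM kappa0 coer.
have [k k0 kG] := gradient_lipschitz sL gL.
have [b b0 bM] := norm_mulmx_le (invmx M).
pose a := kappa * (d%:R * b).
have a0 : 0 <= a by rewrite !mulr_ge0.
apply: (@continuation_surjective R 'cV[R]_d G (mulmx M) k (b * (1 + a))) => //.
- by rewrite mulr_ge0 // addr_ge0.
- by move=> y; exists (invmx M *m y); rewrite mulKVmx.
move=> t /andP[t0 t1] x y; rewrite -mulmxBr.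
have := orthproj_gradient_diff gL y x.
have := cocoercive sL gL y x; have := pinv_quad_ge0 sL gL y x.
move: (G x - G y) (x - y) => w D q0 qD Qw; set phi := t *: w + M *m D.
have QW : orthproj_ker Lt *m (t *: w) = 0 by rewrite -scalemxAr Qw scaler0.
(* Cocoercivity survives the scaling because [t^2 <= t] on [0, 1]. *)
have WD : quad (pinv Lt) (t *: w) <= dot (t *: w) D.
  move: q0 qD; rewrite !quadE -scalemxAr !dotB => q0 qD.
  apply: ler_wpM2l => //; apply: le_trans qD.
  by rewrite ler_piMl.
have DE : D = invmx M *m (phi - t *: w) by rewrite addrC addKr mulKmx.
have Wphi : `|t *: w| <= a * `|phi|.
  have [->|W0] := eqVneq (t *: w) 0; first by rewrite normr0 mulr_ge0.
  have Wgt0 : 0 < `|t *: w| by rewrite normr_gt0.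
  rewrite -(ler_pM2r Wgt0) -expr2 (le_trans (coer _ QW)) //.
  rewrite /a -!mulrA ler_wpM2l //.
  (* Since [M^-1 phi = M^-1 W + D], the bound on [W^T D] absorbs the pseudoinverse term. *)
  apply: (@le_trans _ _ (dot (t *: w) (invmx M *m phi))).
    by rewrite [X in _ <= dot _ X]mulmxDr mulKmx // dotDr lerD2l.
  rewrite (le_trans (ler_norm _)) // (le_trans (norm_dot_le _ _)) //.
  rewrite ler_wpM2l // mulrC mulrA ler_wpM2r //.
rewrite {1}DE (le_trans (bM _)) // -mulrA ler_wpM2l // mulrDl mul1r.
by rewrite (le_trans (ler_normB _ _)) // lerD2l.
Qed.

End CriticalPoint.

(** The middle term of [class_S] is the Bregman divergence of [f]; subtracting the quadratic of [M]
    shifts both bounds by it. *)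
Lemma class_S_bregman (R : realType) d (M L : 'M[R]_d) f :
  symmetric_mx M -> class_S M L f ->
  forall z1 z2,
    0 <= bregman (fun z => f z - 2^-1 * quad M z)
                 (fun z => gradient f z - M *m z) z1 z2
      <= 2^-1 * quad (L - M) (z2 - z1).
Proof.
move=> sM [_ fML] z1 z2; have := fML z1 z2; rewrite /bregman.
rewrite -/(dot (gradient f z1) (z1 - z2)) -(opprB z2 z1).
rewrite !quadE mulmxBl !mulmxN !mulmxBr !dotB (dotC (M *m z1)) (dotC (M *m z1)).
rewrite (dot_sym z1 z2 sM); lra.
Qed.

(** * Lyapunov function and geometric convergence *)

Section Lyapunov.
Context {R : realType} {n d : nat}.
Variables (At : 'M[R]_n) (B : 'M[R]_(n, d)) (C : 'M[R]_(d, n)) (Lt : 'M[R]_d).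
Variables (rho lam r : R) (P : 'M[R]_(n + d)).
Variables (g : 'cV[R]_d -> R) (G : 'cV[R]_d -> 'cV[R]_d).
Hypothesis sL : symmetric_mx Lt.
Hypothesis gL :
  forall z1 z2, 0 <= bregman g G z1 z2 <= 2^-1 * quad Lt (z2 - z1).
Hypothesis P0 : posdef P.
Hypothesis lam_bounds : 0 <= lam <= rho ^+ 2.
Hypothesis rho_bounds : 0 <= rho < 1.

Let E := lmi_E At B.
Hypothesis lmi : negdef (E^T *m lmi_P rho P *m E
                         + E^T *m lmi_multiplier lam r C Lt *m E).

Lemma lmi_static_coercive : At - 1%:M \in unitmx ->
  exists2 c, 0 <= c & forall u, orthproj_ker Lt *m u = 0 ->
    `|u| ^+ 2 <=
      c * (dot u (C *m invmx (At - 1%:M) *m B *m u) + quad (pinv Lt) u).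
Proof.
move=> uK; have [c c0 cX] := negdef_coercive lmi.
have /andP[r0 r1] := rho_bounds; have /andP[l0 lr] := lam_bounds.
have rr1 : rho ^+ 2 < 1 by rewrite expr_lt1.
have l1 : 0 <= 1 - lam by lra.
exists (c * (1 - lam)) => [|u Qu]; first by rewrite mulr_ge0.
set x := - (invmx (At - 1%:M) *m B *m u).
have xE : At *m x + B *m u = x.
  apply/eqP; rewrite -subr_eq0 addrAC -{2}(mul1mx x) -mulmxBl /x mulmxN.
  by rewrite -mulmxA mulKVmx // addNr.
have := cX (col_mx (col_mx x u) u).
rewrite quad_lmi // xE => H.
apply: (@le_trans _ _ (`|col_mx (col_mx x u) u| ^+ 2)).
  by rewrite lerXn2r ?nnegrE // norm_dsub_le.
rewrite (le_trans H) // -mulrA ler_wpM2l //.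
have -> : C *m invmx (At - 1%:M) *m B *m u = - (C *m x).
  by rewrite /x mulmxN opprK !mulmxA.
have : 0 <= (1 - rho ^+ 2) * quad P (col_mx x u).
  apply: mulr_ge0; first by rewrite subr_ge0 ltW.
  have [->|x0] := eqVneq (col_mx x u) 0; first by rewrite quad0.
  by have [_ /(_ _ x0)/ltW] := P0.
rewrite !quadE !dotB; lra.
Qed.

Variable xf : 'cV[R]_n.
Hypothesis xf_fixed : At *m xf + B *m G (C *m xf) = xf.

(** The bracket is the gap in [bregman_ge_pinv], hence nonnegative. *)
Definition lyapunov x :=
  let w := G (C *m x) - G (C *m xf) in
  quad P (col_mx (x - xf) w)
  + (bregman g G (C *m xf) (C *m x) - 2^-1 * quad (pinv Lt) w).

Lemma lyapunov_decrease x :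
  lyapunov (At *m x + B *m G (C *m x)) <= rho ^+ 2 * lyapunov x.
Proof.
set x' := At *m x + _; rewrite /lyapunov.
have /andP[l0 lr] := lam_bounds; have /andP[r0 r1] := rho_bounds.
have rr1 : rho ^+ 2 < 1 by rewrite expr_lt1.
have l1 : 0 <= 1 - lam by lra.
have xE : At *m (x - xf) + B *m (G (C *m x) - G (C *m xf)) = x' - xf.
  by rewrite !mulmxBr addrACA -opprD xf_fixed.
have := negdef_quad_le0
  (col_mx (col_mx (x - xf) (G (C *m x) - G (C *m xf)))
          (G (C *m x') - G (C *m xf))) lmi.
rewrite quad_lmi ?(orthproj_gradient_diff gL) // xE.
have I1 := bregman_ge_pinv sL gL (C *m x') (C *m xf).
have I2 := bregman_ge_pinv sL gL (C *m x') (C *m x).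
have I3 := bregman_ge_pinv sL gL (C *m xf) (C *m x).
have {I1} I1 := ler_wpM2l l1 I1.
have {I2} I2 := ler_wpM2l l0 I2.
(* [I1] and [I2] bound the new gap by [lam] times the old gap plus the supply terms; [I3] raises the
   factor [lam] to [rho^2]. *)
have {I3} I3 : 0 <= (rho ^+ 2 - lam) * (bregman g G (C *m xf) (C *m x)
    - 2^-1 * quad (pinv Lt) (G (C *m x) - G (C *m xf))).
  by rewrite mulr_ge0 // subr_ge0.
move: (quad P _) (quad P _) => V V'.
move: I1 I2 I3; rewrite /bregman !mulmxBr.
move: (C *m x) (C *m x') (C *m xf) => z z' zs.
move: (G z) (G z') (G zs) => u u' us.
rewrite !quadE !mulmxBr !dotB.
have Ld a b := dot_sym a b (pinv_sym sL).
rewrite (Ld us u') (Ld us u) (Ld u' u); lra.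
Qed.

Lemma lyapunov_ge : exists2 c, 0 <= c & forall x, `|x - xf| ^+ 2 <= c * lyapunov x.
Proof.
have [c c0 cP] := posdef_coercive P0; exists c => // x.
set w := G (C *m x) - G (C *m xf).
apply: (@le_trans _ _ (`|col_mx (x - xf) w| ^+ 2)).
  by rewrite lerXn2r ?nnegrE // norm_usub_le.
rewrite (le_trans (cP _)) // ler_wpM2l // lerDl subr_ge0.
exact: bregman_ge_pinv.
Qed.

(** The gradient is Lipschitz, and the gap is at most the Bregman divergence, which is quadratically
    bounded. *)
Lemma lyapunov_le : exists2 c, 0 <= c & forall x, lyapunov x <= c * `|x - xf| ^+ 2.
Proof.
have [c c0 cP] := quad_le P; have [b b0 bL] := quad_le Lt.
have [k k0 kG] := gradient_lipschitz sL gL; have [a a0 aC] := norm_mulmx_le C.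
exists (c * (1 + k * a) ^+ 2 + 2^-1 * (b * a ^+ 2)) => [|x].
  by rewrite addr_ge0 // !mulr_ge0 // addr_ge0 // mulr_ge0.
have Cx : `|C *m x - C *m xf| <= a * `|x - xf| by rewrite -mulmxBr.
rewrite /lyapunov mulrDl lerD //.
  rewrite (le_trans (cP _)) // -mulrA ler_wpM2l // -exprMn.
  rewrite lerXn2r ?nnegrE ?mulr_ge0 ?addr_ge0 ?mulr_ge0 //.
  rewrite (le_trans (norm_col_mx_le _ _)) // mulrDl mul1r lerD2l.
  by rewrite (le_trans (kG _ _)) // -mulrA ler_wpM2l.
have := pinv_quad_ge0 sL gL (C *m xf) (C *m x).
have /andP[_] := gL (C *m xf) (C *m x).
have := bL (C *m x - C *m xf).
have : b * `|C *m x - C *m xf| ^+ 2 <= b * (a * `|x - xf|) ^+ 2.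
  by rewrite ler_wpM2l // lerXn2r ?nnegrE ?mulr_ge0.
rewrite exprMn; lra.
Qed.

Lemma iterates_converge : exists2 c, 0 <= c & forall x : nat -> 'cV[R]_n,
  (forall k, x k.+1 = At *m x k + B *m G (C *m x k)) ->
  forall k, enorm (xf - x k) <= c * rho ^+ k * enorm (xf - x 0%N).
Proof.
have /andP[r0 _] := rho_bounds.
have [a a0 aV] := lyapunov_ge; have [b b0 bV] := lyapunov_le.
(* The second factor comes from the two-sided bounds on [lyapunov], the first from passing from the
   sup norm to the Euclidean norm. *)
exists (Num.sqrt n%:R * Num.sqrt (a * b)) => [|x xS k].
  by rewrite mulr_ge0 // sqrtr_ge0.
have Vk : lyapunov (x k) <= (rho ^+ k) ^+ 2 * lyapunov (x 0%N).
  elim: k => [|k IH]; first by rewrite expr0 expr1n mul1r.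
  rewrite xS (le_trans (lyapunov_decrease _)) // (exprS _ k) exprMn.
  by rewrite -[leRHS]mulrA ler_wpM2l ?sqr_ge0.
have xk : `|x k - xf| <= Num.sqrt (a * b) * (rho ^+ k * `|x 0%N - xf|).
  have rk : 0 <= rho ^+ k * `|x 0%N - xf| by rewrite mulr_ge0 ?exprn_ge0.
  rewrite -(ger0_norm rk) -[leLHS]normr_id -!sqrtr_sqr -sqrtrM ?mulr_ge0 //.
  rewrite ler_sqrt ?mulr_ge0 ?exprn_ge0 //.
  rewrite (le_trans (aV _)) // -mulrA ler_wpM2l // (le_trans Vk) //.
  by rewrite exprMn mulrCA ler_wpM2l ?sqr_ge0.
rewrite (le_trans (enorm_le_norm _)) // -!mulrA ler_wpM2l ?sqrtr_ge0 //.
rewrite distrC (le_trans xk) // ler_wpM2l ?sqrtr_ge0 // ler_wpM2l ?exprn_ge0 //.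
by rewrite distrC norm_le_enorm.
Qed.

End Lyapunov.

(** * Return from the shifted loop to [A] and the gradient of [f] *)

Unset Implicit Arguments.

Theorem theorem13 (R : realType) (n d : nat) (M L : 'M[R]_d) (rho : R)
    (A : 'M[R]_n) (B : 'M[R]_(n, d)) (C : 'M[R]_(d, n)) :
  symmetric_mx M -> symmetric_mx L -> loewner_le M L ->
  (d <= n)%N -> 0 <= rho < 1 ->
  let At := A + B *m M *m C in
  let Lt := L - M in
  let E := lmi_E At B in
  (exists (P : 'M[R]_(n + d)) (lam r : R),
    [/\ posdef P,
        0 <= lam <= rho ^+ 2,
        At - 1%:M \in unitmx /\
          C *m invmx (At - 1%:M) *m B *m M = 1%:M &
        negdef (E^T *m lmi_P rho P *m E
                + E^T *m lmi_multiplier lam r C Lt *m E)]) ->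
  forall f : 'cV[R]_d -> R, class_S M L f ->
  exists (xf : 'cV[R]_n) (cf : R),
    [/\ 0 <= cf,
        gradient f (C *m xf) = 0 &
        forall (x0 : 'cV[R]_n) (x : nat -> 'cV[R]_n),
          x 0%N = x0 ->
          (forall k, x k.+1 = A *m x k + B *m gradient f (C *m x k)) ->
          forall k, enorm (xf - x k) <= cf * rho ^+ k * enorm (xf - x0)].
Proof.
move=> sM sL _ _ rho01 At Lt E [P [lam [r [P0 lam01 [uK CKBM] lmi]]]] f fML.
have sLt : symmetric_mx Lt by rewrite /symmetric_mx /Lt linearB /= sM sL.
have gL := class_S_bregman sM fML.
set g := (fun z => f z - _) in gL; set G := (fun z => gradient f z - _) in gL.
have [_ uM] := mulmx1_unit CKBM.
have [c c0 coer] := lmi_static_coercive sLt P0 lam01 rho01 lmi uK.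
(* This turns [coer] into the hypothesis of [critical_point_exists]. *)
have CKB : C *m invmx (At - 1%:M) *m B = invmx M.
  by rewrite -[LHS](mulmxK uM) CKBM mul1mx.
rewrite CKB in coer.
have [z] := critical_point_exists sLt gL uM c0 coer; rewrite /G subrK => z0.
have GE x : At *m x + B *m G (C *m x) = A *m x + B *m gradient f (C *m x).
  by rewrite /At /G mulmxDl mulmxBr !mulmxA addrAC -addrA subrK.
(* The steady state for the constant input [G z = - M z]; the gain condition makes its output
   [z]. *)
pose xf := invmx (At - 1%:M) *m B *m M *m z.
have Cxf : C *m xf = z by rewrite /xf !mulmxA CKBM mul1mx.
have xf_fixed : At *m xf + B *m G (C *m xf) = xf.
  rewrite Cxf /G z0 sub0r mulmxN; apply/eqP.
  rewrite -subr_eq0 addrAC -{2}(mul1mx xf) -mulmxBl /xf -!mulmxA mulKVmx //.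
  by rewrite !mulmxA subrr.
have [b b0 bx] := iterates_converge sLt gL P0 lam01 rho01 lmi xf_fixed.
exists xf, b; split=> // [|x0 x <- xS]; first by rewrite Cxf.
by apply: bx => k; rewrite xS GE.
Qed.
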